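(* If $G$ is a square-chordal graph, then its injective hull $\mathcal{H}(G)$ is square-chordal.
   Context: Graphs are finite, connected, simple, with shortest-path metric $d_G$. The $k$-th power $G^k$ has vertex set $V(G)$ with distinct $u,v$ adjacent iff $d_G(u,v)\le k$. A graph is chordal if it has no induced cycle of length at least 4, and $G$ is square-chordal if $G^2$ is chordal. A graph is Helly if every family of pairwise intersecting disks $D(v,r)=\{u:d(u,v)\le r\}$ has a common vertex. The injective hull $\mathcal{H}(G)$ is the unique minimal Helly graph containing $G$ as an isometric subgraph (equivalently, the graph on functions $f:V(G)\to\mathbb{Z}_{\ge0}$ with $f(x)+f(y)\ge d_G(x,y)$ for all $x,y$ and for each $x$ some $y$ with equality, adjacency meaning sup-norm distance 1). *)

(* Defs.v *)
From mathcomp Require Import all_boot ssrint.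
Import IntDist.
Set Implicit Arguments.
Unset Strict Implicit.
Unset Printing Implicit Defensive.

Record sgraph := SGraph {
  vertex :> finType;
  adj : rel vertex;
  adj_sym : symmetric adj;
  adj_irr : irreflexive adj }.

Definition connected_graph (G : sgraph) : Prop :=
  forall x y : G, connect (@adj G) x y.

Definition walk_of_length (G : sgraph) (x y : G) (n : nat) : bool :=
  [exists p : n.-tuple G, path (@adj G) x p && (last x p == y)].

(** In a connected graph a shortest path has at most [#|G| - 1] edges, so the
    search below succeeds; [dist x y = #|G|] signals that [x] and [y] lie in
    different components. *)
Definition dist (G : sgraph) (x y : G) : nat :=
  find (walk_of_length x y) (iota 0 #|G|).

Lemma walk_of_length_sym (G : sgraph) (x y : G) n :
  walk_of_length x y n = walk_of_length y x n.
Proof.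
suff imp (u v : G) : walk_of_length u v n -> walk_of_length v u n.
  by apply/idP/idP; apply: imp.
case/existsP=> p /andP[pP /eqP <-]; apply/existsP.
have szq : size (rev (belast u p)) == n by rewrite size_rev size_belast size_tuple.
exists (Tuple szq); rewrite /= rev_path -(eq_path (e := @adj G)) ?pP /=; last first.
  by move=> a b; rewrite adj_sym.
by case: (tval p) => [|a s] //=; rewrite rev_cons last_rcons.
Qed.

Lemma dist_sym (G : sgraph) (x y : G) : dist x y = dist y x.
Proof. by apply: eq_find => n; apply: walk_of_length_sym. Qed.

Lemma dist_bound (G : sgraph) (x y : G) : dist x y < #|G|.+1.
Proof. by rewrite ltnS -[X in _ <= X](size_iota 0) find_size. Qed.

Section Power.
Variables (G : sgraph) (k : nat).

Definition power_adj : rel G := fun u v => (u != v) && (dist u v <= k).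

Lemma power_adj_sym : symmetric power_adj.
Proof. by move=> u v; rewrite /power_adj eq_sym dist_sym. Qed.

Lemma power_adj_irr : irreflexive power_adj.
Proof. by move=> u; rewrite /power_adj eqxx. Qed.

Definition power : sgraph := SGraph power_adj_sym power_adj_irr.

End Power.

(** [next c x] is the cyclic successor of [x] in [c], so the last conjunct says
    that the only edges between vertices of [c] are those of the cycle. *)
Definition induced_cycle (G : sgraph) (c : seq G) : Prop :=
  [/\ uniq c, cycle (@adj G) c &
      forall x y, x \in c -> y \in c -> adj x y -> y = next c x \/ x = next c y].

Definition chordal (G : sgraph) : Prop :=
  forall c : seq G, 4 <= size c -> ~ induced_cycle c.

Definition square_chordal (G : sgraph) : Prop := chordal (power G 2).

Definition extremal (G : sgraph) (f : G -> nat) : bool :=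
  [forall x, forall y, dist x y <= f x + f y] &&
  [forall x, exists y, f x + f y == dist x y].

(** An extremal function is bounded by the largest distance, so nothing is lost
    by taking values in ['I_#|G|.+1]: see [extremal_hull_vertex]. *)
Definition hull_vertex (G : sgraph) : finType :=
  {f : {ffun G -> 'I_#|G|.+1} | extremal (fun x => f x : nat)}.

Definition hull_fun (G : sgraph) (f : hull_vertex G) (x : G) : nat := sval f x.

Lemma extremal_hull_vertex (G : sgraph) (f : G -> nat) :
  extremal f -> exists h : hull_vertex G, hull_fun h =1 f.
Proof.
move=> fP; have fb x : f x < #|G|.+1.
  case/andP: fP => _ /forallP/(_ x)/existsP[y /eqP fxy].
  by apply: leq_ltn_trans (dist_bound x y); rewrite -fxy leq_addr.
pose g : {ffun G -> 'I_#|G|.+1} := [ffun x => Ordinal (fb x)].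
have gE x : g x = f x :> nat by rewrite ffunE.
have gP : extremal (fun x => g x : nat).
  case/andP: fP => /forallP fle /forallP feq.
  apply/andP; split; apply/forallP => x.
    by apply/forallP => y; rewrite !gE; apply/forallP: y.
  have /existsP[y /eqP fxy] := feq x.
  by apply/existsP; exists y; rewrite !gE fxy.
by exists (exist _ g gP) => x; rewrite /hull_fun /= gE.
Qed.

Section Hull.
Variable G : sgraph.
Implicit Types f g : hull_vertex G.

Definition sup_dist f g : nat :=
  \max_(x : G) `|hull_fun f x - hull_fun g x|%N.

Definition hull_adj : rel (hull_vertex G) := fun f g => sup_dist f g == 1.

Lemma hull_adj_sym : symmetric hull_adj.
Proof.
by move=> f g; congr (_ == _); apply: eq_bigr => x _; rewrite distnC.
Qed.

Lemma hull_adj_irr : irreflexive hull_adj.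
Proof.
by move=> f; rewrite /hull_adj /sup_dist big1 // => x _; rewrite distnn.
Qed.

(** The injective hull (tight span). *)
Definition hull : sgraph := SGraph hull_adj_sym hull_adj_irr.

End Hull.

(* Main.v *)
(** By Dirac's theorem a chordal [G^2] has a perfect elimination order, hence a
    clique tree: each vertex [v] gets a subtree [T_v] of a rooted tree on [V(G)],
    and [T_u], [T_v] meet iff [d(u,v) <= 2].  The unions [B(x,r)] of the [T_y]
    with [d(x,y) <= r] are again subtrees, and [B(x,r)] meets [B(y,s)] iff
    [d(x,y) <= r + s + 2].  For a vertex [f] of the hull the [B(x,f(x))] meet
    pairwise, so by the Helly property they share a subtree [T_f]; the [T_f]
    represent the square of the hull, because [T_f] meets [T_g] iff
    [d(x,y) <= f(x) + g(y) + 2] for all [x], [y], i.e. iff [|f - g| <= 2].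
    In such a representation the vertex whose subtree has the lowest top is
    simplicial, which no vertex of an induced cycle of length at least 4 is. *)

Require Import Defs.
From mathcomp Require Import all_boot.
From mathcomp Require Import ssrint zify.
Import IntDist.

Set Implicit Arguments.
Unset Strict Implicit.
Unset Printing Implicit Defensive.

(** * Chordless paths and induced cycles *)

(** A walk with the fewest edges works. The vertex [nth x p k] stands at position [k.+1] of
    [x :: p], so [k = i] means that the edge joins consecutive vertices. *)
Lemma chordless_path (T : finType) (e : rel T) (x y : T) :
  connect e x y ->
  exists p, [/\ path e x p, last x p = y, uniq (x :: p) &
    forall i k, i <= k < size p ->
      e (nth x (x :: p) i) (nth x p k) -> k = i].
Proof.
pose P n := [exists p : n.-tuple T, path e x p && (last x p == y)].
have PI p : path e x p -> last x p = y -> P (size p).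
  by move=> ep lp; apply/existsP; exists (in_tuple p); rewrite ep lp eqxx.
case/connectP=> p0 ep0 lp0.
have exP : exists n, P n by exists (size p0); apply: PI.
case: (ex_minnP exP) => n /existsP[p /andP[ep /eqP lp]] minn {p0 ep0 lp0 exP}.
have := size_tuple p; case/shortenP: ep lp => p' ep' up' sp' lp' szp.
have szp' : size p' = n.
  apply/eqP; rewrite eqn_leq minn ?PI // andbT -[X in _ <= X]szp.
  by apply: uniq_leq_size => //; case/andP: up'.
exists p'; split=> // i k /andP[le_ik ltk] eik.
case: (ltngtP i k) le_ik => // lt_ik _.
have lastE m : m <= size p' -> last x (take m p') = nth x (x :: p') m.
  move=> lem; rewrite (last_nth x) size_takel //.
  by rewrite -[x :: take m p']/(take m.+1 (x :: p')) nth_take.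
(* The edge jumps from position [i] to position [k.+1] of the walk, a strict shortcut because
   [i < k]. *)
pose q := take i p' ++ drop k p'.
have qE : drop k p' = nth x p' k :: drop k.+1 p' by rewrite (drop_nth x).
have eq : path e x q.
  have epk := ep'; rewrite -(cat_take_drop k.+1 p') cat_path lastE // in epk.
  have epi := ep'; rewrite -(cat_take_drop i p') cat_path in epi.
  rewrite cat_path; case/andP: epi => -> _ /=.
  rewrite lastE ?qE /= ?eik; last by lia.
  by case/andP: epk.
have lq : last x q = y.
  by rewrite -lp' -[in RHS](cat_take_drop k p') !last_cat qE.
have le_i : i <= size p' by rewrite ltnW // (ltn_trans lt_ik).
have := minn _ (PI _ eq lq); rewrite size_cat size_takel // size_drop szp'.
by move: ltk lt_ik; rewrite szp'; clear; lia.
Qed.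

(** The witnesses are the two cyclic neighbours of [x]. With at least four vertices on the cycle,
    neither is the successor of the other, so an edge between them would be a chord. *)
Lemma induced_cycle_nonadjacent (G : sgraph) (c : seq G) x :
  4 <= size c -> induced_cycle c -> x \in c ->
  exists y z, [/\ y \in c, z \in c, adj x y, adj x z & y != z /\ ~~ adj y z].
Proof.
move=> szc [uc cc nc] xc.
case: (rot_to xc) => i s rs.
have memE : c =i x :: s by move=> w; rewrite -rs mem_rot.
have nextE w : next c w = next (x :: s) w by rewrite -rs next_rot.
have : 4 <= size (x :: s) by rewrite -rs size_rot.
have : cycle (@adj G) (x :: s) by rewrite -rs rot_cycle.
have : uniq (x :: s) by rewrite -rs rot_uniq.
case: s {rs} memE nextE => [|a [|b [|d s]]] // memE nextE us cs _.
pose h := last d s.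
have hs : h \in d :: s by rewrite mem_last.
have hl : h = last x [:: a, b, d & s] by [].
have nh : next c h = x.
  rewrite nextE next_nth hl mem_last index_last //=.
  by rewrite nth_default.
have na : next c a = b.
  by rewrite nextE /= eqxx; case: eqP us => // ->; rewrite /= inE eqxx.
have xh : adj x h.
  by move: cs; rewrite (cycle_path x) /= adj_sym => /andP[].
have xa : adj x a by move: cs; rewrite /= => /andP[].
have a_h : a != h.
  by apply: contraTneq us => ->; rewrite !cons_uniq (in_cons b) hs orbT andbF.
have b_h : b != h.
  by apply: contraTneq us => ->; rewrite !cons_uniq hs !andbF.
have x_a : x != a by apply: contraTneq xa => ->; rewrite adj_irr.
have ac : a \in c by rewrite memE !inE eqxx orbT.
have hc : h \in c by rewrite memE hl mem_last.
exists a, h; split=> //; split=> //.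
apply/negP => ah; case: (nc _ _ ac hc ah) => E.
  by move: b_h; rewrite E na eqxx.
by move: x_a; rewrite E nh eqxx.
Qed.

(** * Simplicial vertices and perfect elimination orders *)

Section Dirac.
Variable G : sgraph.

Definition simplicial (A : {set G}) (w : G) : Prop :=
  w \in A /\ {in A &, forall y z, adj w y -> adj w z -> y != z -> adj y z}.

(** If [s] and [t] were not adjacent, a chordless path joining them through [C] would close up
    through [v] to an induced cycle, since [v] has no neighbour in [C]. *)
Lemma chordal_separator (v s t : G) (C : {set G}) (c : G) :
  chordal G -> c \in C ->
  {in C, forall x,
     connect (fun x y => [&& x \in C, y \in C & adj x y]) c x} ->
  {in C, forall x, (x != v) && ~~ adj v x} ->
  adj v s -> adj v t -> s != t ->
  (exists2 x, x \in C & adj s x) -> (exists2 x, x \in C & adj t x) ->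
  adj s t.
Proof.
move=> chG cC conC vC vs vt s_t [s' s'C ss'] [t' t'C tt'].
apply/negPn/negP => nst.
pose D := [set x | [|| x \in C, x == s | x == t]].
pose e := [rel x y : G | [&& x \in D, y \in D & adj x y]].
have CD x : x \in C -> x \in D by rewrite inE => ->.
have sD : s \in D by rewrite inE eqxx orbT.
have tD : t \in D by rewrite inE eqxx !orbT.
have esym : symmetric e by move=> x y; rewrite /= andbCA adj_sym.
have csym := sym_connect_sym esym.
have conD x : x \in C -> connect e c x.
  move/conC; apply: connect_sub => a b /and3P[aC bC ab].
  by apply: connect1; rewrite /= !CD.
have est : connect e s t.
  apply: (@connect_trans _ _ s'); first by apply: connect1; rewrite /= sD CD.
  apply: (@connect_trans _ _ c); first by rewrite csym conD.
  apply: (@connect_trans _ _ t'); first exact: conD.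
  by apply: connect1; rewrite /= tD CD // adj_sym.
have [p [ep lp up chp]] := chordless_path est.
have pD : {subset s :: p <= D}.
  move=> x; rewrite inE => /orP[/eqP-> //|].
  elim: p (s) ep {lp up chp} => //= a p IH b /andP[/and3P[_ aD _] ep].
  by rewrite inE => /orP[/eqP->|/(IH _ ep)].
have vD : v \notin D.
  rewrite inE !negb_or; apply/and3P; split.
  - by apply/negP => /vC; rewrite eqxx.
  - by apply: contraTneq vs => ->; rewrite adj_irr.
  - by apply: contraTneq vt => ->; rewrite adj_irr.
have vsp : v \notin s :: p by apply: contra vD => /pD.
(* Distinct non-adjacent ends force two edges, so adding [v] gives a cycle of at least four
   vertices. *)
have size_p : 1 < size p.
  case: (p) ep lp => [|a [|b r]] //= => [_ /eqP|]; first by rewrite (negPf s_t).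
  by case/andP=> /and3P[_ _ sa] _ at_; rewrite -at_ sa in nst.
have adjp : path (@adj G) s p.
  by apply: sub_path ep => a b /and3P[].
pose c0 := v :: s :: p.
have uc : uniq c0 by rewrite cons_uniq vsp.
have nv : next c0 v = s by rewrite /= eqxx.
have nt : next c0 t = v.
  rewrite next_nth -lp -[last s p]/(last v (s :: p)) mem_last index_last //.
  by rewrite /= nth_default.
have ns i : i < size p -> next c0 (nth s (s :: p) i) = nth s p i.
  move=> lti; rewrite next_nth.
  have ini : nth s (s :: p) i \in s :: p by rewrite mem_nth //= ltnW.
  rewrite inE ini orbT /=.
  have -> : (v == nth s (s :: p) i) = false.
    by apply: contraNF vsp => /eqP->.
  rewrite -[if _ == _ then _ else _]/(index (nth s (s :: p) i) (s :: p)).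
  by rewrite index_uniq //= ?(set_nth_default s) // ltnW.
apply: (chG c0); first by rewrite /= !ltnS.
split=> //.
  rewrite /= rcons_path vs adjp lp /= adj_sym //.
have half x y : x \in s :: p -> y \in s :: p -> index x (s :: p) < index y (s :: p) ->
    adj x y -> y = next c0 x.
  move=> xs ys lt_xy xy.
  have exy : e x y by rewrite /= (pD _ xs) (pD _ ys).
  have xE := nth_index s xs; have yE := nth_index s ys.
  have yb : index y (s :: p) < (size p).+1 by have := ys; rewrite -index_mem.
  case: (index y (s :: p)) lt_xy yE yb => // k; rewrite !ltnS => le_xk yE ltk.
  rewrite -[nth _ _ _]/(nth s p k) in yE.
  have := chp (index x (s :: p)) k; rewrite le_xk ltk xE yE => /(_ isT exy) E.
  by move: (ns (index x (s :: p))); rewrite xE -E yE => /(_ ltk) ->.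
have vcase y : y \in s :: p -> adj v y -> y = next c0 v \/ v = next c0 y.
  move=> ys vy; have := pD _ ys; rewrite inE => /or3P[/vC|/eqP->|/eqP->].
  - by rewrite vy andbF.
  - by left.
  - by right.
move=> x y; rewrite !(in_cons v) => /predU1P[->|xs] /predU1P[->|ys] xy.
- by rewrite adj_irr in xy.
- exact: vcase.
- by case: (vcase x xs); rewrite 1?adj_sym //; [right|left].
case: (ltngtP (index x (s :: p)) (index y (s :: p))) => [lt|lt|E].
- by left; apply: half.
- by right; apply: half; rewrite // adj_sym.
- by move: xy; rewrite -(nth_index s xs) E nth_index // adj_irr.
Qed.

(* Fixing a non-neighbour [v] makes the induction work: let [C] be a component of
   the non-neighbours of [v] and [S] its boundary, a clique; a simplicial vertex
   of [C :|: S] lying in [C] is simplicial in [A]. *)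
Lemma dirac (A : {set G}) (v u : G) :
  chordal G -> v \in A -> u \in A -> u != v -> ~~ adj v u ->
  exists w, [/\ simplicial A w, w != v & ~~ adj v w].
Proof.
move=> chG; move: {2}#|A|.+1 (ltnSn #|A|) => n.
elim: n A v u => // n IH A v u; rewrite ltnS => leA vA uA u_v nvu.
pose B := [set x in A | (x != v) && ~~ adj v x].
pose e := [rel x y | [&& x \in B, y \in B & adj x y]].
pose C := [set x | connect e u x].
pose S := [set x in A | adj v x && [exists y in C, adj x y]].
have uB : u \in B by rewrite inE uA u_v.
have esym : symmetric e by move=> x y; rewrite /= andbCA adj_sym.
have uC : u \in C by rewrite inE connect0.
have CB x : x \in C -> x \in B.
  rewrite inE => /connectP[p]; elim/last_ind: p => [|p z _]; first by move=> _ ->.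
  by rewrite rcons_path last_rcons => /andP[_ /and3P[_ zB _]] ->.
have vC x : x \in C -> (x != v) && ~~ adj v x.
  by move/CB; rewrite inE => /andP[].
have C_A x : x \in C -> x \in A by move/CB; rewrite inE => /andP[].
have Cclos x y : x \in C -> y \in A -> adj x y -> y \in C :|: S.
  move=> xC yA xy; rewrite inE; case vy: (adj v y).
    rewrite [y \in S]inE yA vy /=; apply/orP; right; apply/existsP; exists x.
    by rewrite xC adj_sym.
  have yv : y != v.
    by apply: contraTneq xy => ->; rewrite adj_sym; case/andP: (vC _ xC).
  have yB : y \in B by rewrite inE yA yv vy.
  move: (xC); rewrite !inE => ux; rewrite (connect_trans ux) //.
  by apply: connect1; rewrite /= yB (CB x xC).
have Scl : {in S &, forall s t, s != t -> adj s t}.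
  move=> s t; rewrite !inE => /and3P[_ vs /exists_inP hs] /and3P[_ vt /exists_inP ht] s_t.
  apply: (chordal_separator (C := C) (c := u) (v := v)) => //.
  move=> x; rewrite inE => /connectP[p]; elim/last_ind: p x => [|p z IHp] x.
    by move=> _ ->; apply: connect0.
  rewrite rcons_path last_rcons => /andP[ep ez ->].
  apply: connect_trans (IHp _ ep erefl) _; apply: connect1.
  have lC : last u p \in C by rewrite inE; apply/connectP; exists p.
  case/and3P: (ez) => _ _ ->; rewrite lC inE (connect_trans (_ : connect e u (last u p))) //.
    by rewrite inE in lC.
  exact: connect1.
pose A' := C :|: S.
have A'A : A' \subset A.
  by apply/subsetP => x /setUP[/C_A //|]; rewrite inE => /andP[].
have vA' : v \notin A'.
  rewrite inE negb_or; apply/andP; split; first by apply/negP => /vC; rewrite eqxx.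
  by rewrite inE adj_irr andbF.
have ltA' : #|A'| < n.
  apply: leq_trans leA; apply: proper_card; apply/properP; split=> //.
  by exists v.
have lift w : w \in C -> simplicial A' w -> exists w, [/\ simplicial A w, w != v & ~~ adj v w].
  move=> wC [_ wS]; exists w; case/andP: (vC _ wC) => -> ->; split=> //; split; first exact: C_A.
  by move=> y z yA zA wy wz; apply: wS => //; apply: Cclos wC _ _.
(* The induction is applied with [s] in the role of [v]: the vertex found is not adjacent to [s],
   hence lies outside the clique [S] and so in [C]. *)
case: (boolP [exists s in S, exists x in A', (x != s) && ~~ adj s x]).
  case/exists_inP=> s sS /exists_inP[x xA' /andP[x_s nsx]].
  have sA' : s \in A' by rewrite inE sS orbT.
  have [w [wS w_s nsw]] := IH _ _ _ ltA' sA' xA' x_s nsx.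
  case: (wS) => /setUP[wC _|wS' _]; first exact: lift wC wS.
  by rewrite Scl // eq_sym in nsw.
move=> Suniv.
have Su s x : s \in S -> x \in A' -> x != s -> adj s x.
  move=> sS xA' x_s; apply: contraNT Suniv => nsx; apply/exists_inP; exists s => //.
  by apply/exists_inP; exists x; rewrite ?x_s.
(* Each vertex of [S] is now adjacent to all others of [A'], so a vertex found from a non-adjacent
   pair again lies in [C]. *)
case: (boolP [exists s in C, exists x in A', (x != s) && ~~ adj s x]).
  case/exists_inP=> s sC /exists_inP[x xA' /andP[x_s nsx]].
  have sA' : s \in A' by rewrite inE sC.
  have [w [wS w_s nsw]] := IH _ _ _ ltA' sA' xA' x_s nsx.
  case: (wS) => /setUP[wC _|wS' _]; first exact: lift wC wS.
  by rewrite adj_sym Su // eq_sym in nsw.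
move=> Cuniv.
have Cu s x : s \in C -> x \in A' -> x != s -> adj s x.
  move=> sS xA' x_s; apply: contraNT Cuniv => nsx; apply/exists_inP; exists s => //.
  by apply/exists_inP; exists x; rewrite ?x_s.
(* In the remaining case [A'] is a clique. *)
apply: (lift u uC); split; first by rewrite inE uC.
move=> y z yA' zA' uy uz y_z; case/setUP: yA' => [yC|yS].
  by apply: Cu; rewrite // eq_sym.
by apply: Su; rewrite // eq_sym.
Qed.

(** A perfect elimination order read backwards: the vertex of largest index is eliminated first. *)
Definition elimination_order (A : {set G}) (idx : G -> nat) : Prop :=
  {in A &, injective idx} /\
  {in A & &, forall x y z, adj x y -> adj x z ->
     idx y < idx x -> idx z < idx x -> y != z -> adj y z}.

Lemma chordal_simplicial (A : {set G}) :
  chordal G -> A != set0 -> exists w, simplicial A w.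
Proof.
move=> chG /set0Pn[v vA].
case: (boolP [exists x in A, exists y in A, (y != x) && ~~ adj x y]).
  case/exists_inP=> x xA /exists_inP[y yA /andP[y_x nxy]].
  by have [w []] := dirac chG xA yA y_x nxy; exists w.
move=> cl; exists v; split=> // y z yA zA _ _ y_z.
apply: contraNT cl => nyz; apply/exists_inP; exists y => //.
by apply/exists_inP; exists z; rewrite // eq_sym y_z.
Qed.

(** A simplicial vertex receives the index [n]; the bound carried through the induction keeps all
    other indices below it. *)
Lemma chordal_elimination_order :
  chordal G -> exists idx, elimination_order [set: G] idx.
Proof.
move=> chG; suff H n (A : {set G}) : #|A| = n ->
    exists idx, elimination_order A idx /\ {in A, forall x, idx x < n}.
  by have [idx []] := H _ [set: G] erefl; exists idx.
elim: n A => [|n IH] A cardA.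
  move/eqP: cardA; rewrite cards_eq0 => /eqP->; exists (fun=> 0).
  by split; [split|] => x; rewrite ?in_set0 // => y z; rewrite in_set0.
have [|w [wA wS]] := chordal_simplicial (A := A) chG; first by rewrite -card_gt0 cardA.
have cardw : #|A :\ w| = n by have := cardsD1 w A; rewrite wA cardA; case.
have [idx [[inj elim] bnd]] := IH _ cardw.
have inD x : x \in A -> x != w -> x \in A :\ w by move=> xA xw; rewrite !inE xw.
exists (fun x => if x == w then n else idx x); split; [split|].
- move=> x y xA yA; case: eqVneq => [->|xw]; case: eqVneq => [->|yw] // E.
  + by have := bnd y (inD _ yA yw); rewrite E ltnn.
  + by have := bnd x (inD _ xA xw); rewrite E ltnn.
  + by apply: inj; rewrite ?inD.
- move=> x y z xA yA zA; case: (eqVneq x w) => [->|xw].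
    by move=> wy wz _ _; apply: wS.
  have xb := bnd x (inD _ xA xw).
  case: eqVneq => [_ _ _|yw]; first by move/(ltn_trans xb); rewrite ltnn.
  case: eqVneq => [_ _ _ _|zw]; first by move/(ltn_trans xb); rewrite ltnn.
  by apply: elim; rewrite ?inD.
- move=> x xA; case: eqVneq => // xw; apply: ltnW; exact: (bnd x (inD _ xA xw)).
Qed.

End Dirac.

(** * The shortest-path metric *)

Section Distance.
Variable G : sgraph.
Implicit Types x y z : G.

Lemma dist_le_path x p : path (@adj G) x p -> dist x (last x p) <= size p.
Proof.
move=> xp; have w : walk_of_length x (last x p) (size p).
  by apply/existsP; exists (in_tuple p); rewrite xp eqxx.
(* The search in [dist] tries only lengths below [#|G|]; for longer walks the default value [#|G|]
   is small enough. *)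
case: (leqP #|G| (size p)) => [|ltp].
  by apply: leq_trans; rewrite -ltnS dist_bound.
rewrite leqNgt; apply/negP => /(before_find 0).
by rewrite nth_iota // add0n w.
Qed.

(** The hypothesis says that the search in [dist] succeeds; in this form the lemma serves connected
    graphs and the hull alike. *)
Lemma dist_path x y :
  dist x y < #|G| ->
  exists p, [/\ path (@adj G) x p, last x p = y & size p = dist x y].
Proof.
move=> lt_d; have has_w : has (walk_of_length x y) (iota 0 #|G|).
  by rewrite has_find size_iota.
have := nth_find 0 has_w; rewrite nth_iota // add0n => /existsP[p /andP[xp /eqP lp]].
by exists p; rewrite size_tuple.
Qed.

Lemma distxx x : dist x x = 0.
Proof. by apply/eqP; rewrite -leqn0 -[0]/(size (Nil G)) (@dist_le_path x [::]). Qed.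

Lemma adj_dist x y : adj x y -> dist x y <= 1.
Proof. by move=> xy; apply: (@dist_le_path x [:: y]); rewrite /= xy. Qed.

Hypothesis cG : connected_graph G.

Lemma connected_dist x y : dist x y < #|G|.
Proof.
case/connectP: (cG x y) => p xp ->; case/shortenP: xp => q xq uq _.
apply: leq_ltn_trans (dist_le_path xq) _.
by rewrite -[(size q).+1]/(size (x :: q)) -(card_uniqP uq) max_card.
Qed.

Lemma geodesic x y :
  exists p, [/\ path (@adj G) x p, last x p = y & size p = dist x y].
Proof. exact: dist_path (connected_dist x y). Qed.

Lemma dist_triangle x y z : dist x z <= dist x y + dist y z.
Proof.
have [p [xp <- <-]] := geodesic x y; have [q [yq <- <-]] := geodesic (last x p) z.
by rewrite -last_cat -size_cat dist_le_path // cat_path xp.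
Qed.

Lemma dist_split x y m n :
  dist x y <= m + n -> exists2 z, dist x z <= m & dist z y <= n.
Proof.
have [p [xp <- <-]] := geodesic x y => le_p.
have := xp; rewrite -(cat_take_drop m p) cat_path => /andP[xt td].
exists (last x (take m p)); first by apply: leq_trans (dist_le_path xt) _; rewrite size_take_min geq_minl.
by rewrite last_cat; apply: leq_trans (dist_le_path td) _; rewrite size_drop leq_subLR.
Qed.

End Distance.

(** * Subtrees of a rooted tree *)

Section Subtree.
Variables (T : finType) (idx : T -> nat) (par : T -> T).
Hypothesis idx_inj : injective idx.

(* Here [par] is the parent map of a rooted tree, and [t] is the top of [S]. *)
Definition subtree (t : T) (S : {set T}) : Prop :=
  t \in S /\ {in S, forall i, i != t -> par i \in S /\ idx (par i) < idx i}.

(* Walking up the tree from [i], one reaches [t] before leaving [S']. *)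
Lemma subtree_top_in t t' (S S' : {set T}) i :
  subtree t S -> subtree t' S' -> i \in S -> i \in S' ->
  idx t' <= idx t -> t \in S'.
Proof.
move=> [tS St] [tS' St'] iS iS' le_t.
have [n] := ubnP (idx i); elim: n i iS iS' => // n IH i iS iS'; rewrite ltnS => le_i.
case: (eqVneq i t) => [<- //|i_t].
have min_t j : j \in S -> idx t <= idx j.
  have [m] := ubnP (idx j); elim: m j => // m IHm j; rewrite ltnS => le_j jS.
  case: (eqVneq j t) => [-> //|j_t]; have [pS lt_p] := St j jS j_t.
  by apply: leq_trans (ltnW lt_p); apply: IHm => //; apply: leq_trans le_j.
have [pS lt_p] := St i iS i_t.
have i_t' : i != t'.
  apply: contra_neq i_t => E; apply: idx_inj; apply/eqP.
  by rewrite eqn_leq min_t // E le_t.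
have [pS' _] := St' i iS' i_t'.
by apply: (IH (par i)) => //; apply: leq_trans le_i.
Qed.

(** The top of smaller index is the top of the union: by [subtree_top_in] the other top lies in its
    subtree, where the walk upwards continues. *)
Lemma subtree_union t t' (S S' : {set T}) i :
  subtree t S -> subtree t' S' -> i \in S -> i \in S' ->
  exists t0, subtree t0 (S :|: S').
Proof.
wlog le_t : t t' S S' / idx t' <= idx t.
  move=> H St St' iS iS'; case/orP: (leq_total (idx t) (idx t')) => le_t.
    by rewrite setUC; apply: H le_t St' St iS' iS.
  exact: H le_t St St' iS iS'.
move=> St St' iS iS'; have tS' := subtree_top_in St St' iS iS' le_t.
case: St St' => tS St [t'S' St']; exists t'; split; first by rewrite inE t'S' orbT.
have S'case j : j \in S' -> j != t' -> par j \in S :|: S' /\ idx (par j) < idx j.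
  by move=> jS' j_t'; have [] := St' j jS' j_t'; rewrite inE => -> ->; rewrite orbT.
move=> j /setUP[jS|jS'] j_t'; last exact: S'case.
case: (eqVneq j t) => [E|j_t]; first by apply: S'case; rewrite ?E // -E.
by have [] := St j jS j_t; rewrite inE => -> ->.
Qed.

Lemma subtree_star (I : eqType) (r : seq I) (S0 : {set T}) (S : I -> {set T}) t0 :
  subtree t0 S0 ->
  {in r, forall k, (exists t, subtree t (S k)) /\ exists2 i, i \in S0 & i \in S k} ->
  exists t, subtree t (S0 :|: \bigcup_(k <- r) S k).
Proof.
move=> S0t; elim: r => [|k r IH] H; first by exists t0; rewrite big_nil setU0.
have [|t1 St1] := IH; first by move=> j jr; apply: H; rewrite inE jr orbT.
have [[t St] [i iS0 iSk]] := H k (mem_head _ _).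
rewrite big_cons setUCA setUC; apply: subtree_union St1 St _ iSk.
by rewrite inE iS0.
Qed.

End Subtree.

(** * The clique tree of an elimination order *)

Section CliqueTree.
Variables (G : sgraph) (idx : G -> nat).
Hypothesis idxP : elimination_order [set: G] idx.

Lemma elimination_order_inj : injective idx.
Proof. by case: idxP => inj _ x y; apply: inj. Qed.

Lemma elimination_order_adj x y z :
  adj x y -> adj x z -> idx y < idx x -> idx z < idx x -> y != z -> adj y z.
Proof. by case: idxP => _; apply. Qed.

(** A tree node [i] stands for the clique made of [i] and its neighbours of smaller index; this set
    collects the nodes whose clique contains [v]. *)
Definition later_neighbours (v : G) : {set G} :=
  [set i | (i == v) || adj i v && (idx v < idx i)].

Lemma later_neighbours_meet u v i :
  i \in later_neighbours u -> i \in later_neighbours v -> (u == v) || adj u v.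
Proof.
rewrite !inE; case: (eqVneq u v) => //= u_v.
case/predU1P=> [->|/andP[iu lt_u]]; case/predU1P=> [E|/andP[iv lt_v]] //.
- by rewrite E eqxx in u_v.
- by rewrite adj_sym -E.
- exact: elimination_order_adj iu iv lt_u lt_v u_v.
Qed.

Lemma adj_later_neighbours u v :
  (u == v) || adj u v ->
  exists2 i, i \in later_neighbours u & i \in later_neighbours v.
Proof.
case: eqVneq => [->|u_v] /= uv; first by exists v; rewrite inE eqxx.
case: (ltngtP (idx u) (idx v)) => [lt|lt|/elimination_order_inj E].
- by exists v; rewrite inE ?eqxx // adj_sym uv lt orbT.
- by exists u; rewrite inE ?eqxx // uv lt orbT.
- by rewrite E eqxx in u_v.
Qed.

(** The parent of [i] is its neighbour of largest index below that of [i]. The smaller neighbours of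
    [i] form a clique, so any other one, [v], is also a smaller neighbour of the parent. *)
Lemma clique_tree :
  exists par : G -> G, forall v, subtree idx par v (later_neighbours v).
Proof.
have /fin_all_exists[par parP] : forall i, exists p, forall v,
    adj i v -> idx v < idx i -> [/\ adj i p, idx p < idx i & idx v <= idx p].
  move=> i; case: (pickP (fun v => adj i v && (idx v < idx i))) => [v0 v0P|no].
    case: (@arg_maxnP _ v0 (fun v => adj i v && (idx v < idx i)) idx v0P) => p /andP[ip lt_p] maxp.
    by exists p => v iv lt_v; split=> //; apply: maxp; rewrite /= iv.
  (* A node without smaller neighbours is a root and gets itself as parent. *)
  by exists i => v iv lt_v; move: (no v); rewrite iv lt_v.
exists par => v; split; first by rewrite inE eqxx.
move=> i; rewrite inE => /predU1P[->|/andP[iv lt_v] _]; first by rewrite eqxx.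
have [ip lt_p le_p] := parP i v iv lt_v; split=> //.
rewrite inE; case: eqVneq => //= p_v.
rewrite (elimination_order_adj ip iv lt_p lt_v p_v) ltn_neqAle le_p andbT.
by apply: contra_neq p_v => /elimination_order_inj.
Qed.

End CliqueTree.

(** * Thick balls as subtrees of the clique tree of the square *)

Section ThickBalls.
Variables (G : sgraph) (idx : G -> nat).
Hypothesis cG : connected_graph G.
Hypothesis idxP : elimination_order [set: power G 2] idx.

Definition later_square (v : G) : {set G} := @later_neighbours (power G 2) idx v.

(* Plays the role of a disk of radius [r + 1]. *)
Definition thick_ball (x : G) (r : nat) : {set G} :=
  \bigcup_(y | dist x y <= r) later_square y.

Lemma thick_ballP (x : G) r (i : G) :
  reflect (exists2 y, dist x y <= r & i \in later_square y)
    (i \in thick_ball x r).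
Proof. exact: bigcupP. Qed.

(** The sets [later_square u] and [later_square v] meet iff [dist u v <= 2], so the balls meet iff a
    geodesic can be cut into pieces of lengths at most [r], [2] and [s]. *)
Lemma thick_ball_meet (x y : G) r s :
  (exists2 i, i \in thick_ball x r & i \in thick_ball y s) <->
  dist x y <= r + s + 2.
Proof.
split=> [[i /thick_ballP[u xu iu] /thick_ballP[v yv iv]]|].
  have uv : dist u v <= 2.
    have := later_neighbours_meet idxP iu iv.
    by case: eqVneq => [->|_ /andP[]//]; rewrite distxx.
  have := dist_triangle cG x u y; have := dist_triangle cG u v y.
  by rewrite (dist_sym v); lia.
rewrite addnAC => /(dist_split cG)[v xv vy].
have [u xu uv] := dist_split cG xv.
have [|i iu iv] := adj_later_neighbours (u := u) (v := v) idxP.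
  by case: eqVneq => //= u_v; apply/andP.
exists i; apply/thick_ballP; [by exists u|exists v => //].
by rewrite dist_sym.
Qed.

(** The ball of radius [r.+1] at [x] is the union of the balls of radius [r] at the points [y] with
    [dist x y <= 1], all of which meet the one at [x]. *)
Lemma thick_ball_subtree :
  exists par : G -> G, forall (x : G) r, exists t, subtree idx par t (thick_ball x r).
Proof.
have [par parP] := clique_tree idxP; exists par => x r.
elim: r x => [|r IH] x.
  exists x; suff -> : thick_ball x 0 = later_square x by [].
  apply/setP => i; apply/thick_ballP/idP => [[y]|ix]; last by exists x; rewrite ?distxx.
  rewrite leqn0 => /eqP d0; have [p [_ lp sp]] := geodesic cG x y.
  by move: sp lp; rewrite d0; case: p => //= _ <-.
have [t0 St0] := IH x.
pose N := enum [pred y | dist x y <= 1].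
have [|t St] := subtree_star (elimination_order_inj idxP) (S := thick_ball^~ r) (r := N) St0.
  move=> y; rewrite mem_enum => xy; split; first exact: IH.
  by apply/thick_ball_meet; apply: leq_trans xy _; rewrite addn2.
exists t; suff -> : thick_ball x r.+1 = thick_ball x r :|: \bigcup_(y <- N) thick_ball y r by [].
rewrite big_enum /=; apply/setP => i; rewrite inE; apply/thick_ballP/orP.
  case=> z; rewrite -add1n => /(dist_split cG)[y xy yz] iz; right.
  by apply/bigcupP; exists y => //; apply/thick_ballP; exists z.
case=> [/thick_ballP[z xz iz]|/bigcupP[y xy /thick_ballP[z yz iz]]]; exists z => //.
  exact: leqW.
by apply: leq_trans (dist_triangle cG x y z) _; rewrite -add1n leq_add.
Qed.

End ThickBalls.

(** * Sup-norm and graph distance in the hull *)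

Section HullDistance.
Variable G : sgraph.
Implicit Types f g h : hull_vertex G.

Lemma hull_funD f x y : dist x y <= hull_fun f x + hull_fun f y.
Proof. by case/andP: (svalP f) => /forallP/(_ x)/forallP/(_ y). Qed.

Lemma hull_fun_tight f x : exists y, hull_fun f x + hull_fun f y = dist x y.
Proof.
by case/andP: (svalP f) => _ /forallP/(_ x)/existsP[y /eqP E]; exists y.
Qed.

Lemma hull_fun_inj f g : hull_fun f =1 hull_fun g -> f = g.
Proof. by move=> E; apply/val_inj/ffunP => x; apply/val_inj/E. Qed.

Lemma sup_dist_leP f g n :
  reflect (forall x, hull_fun f x <= hull_fun g x + n /\ hull_fun g x <= hull_fun f x + n)
    (sup_dist f g <= n).
Proof.
rewrite /sup_dist; apply: (iffP (bigmax_leqP _ _ _)) => [H x|H x _]; first by have := H x isT; lia.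
by have := H x; lia.
Qed.

(** This turns the sup-norm into the inequality under which thick balls meet. Conversely, a point
    [y] tight for [f] at [x] bounds [hull_fun f x] by [hull_fun g x + n], and likewise for [g]. *)
Lemma sup_dist_le_cross f g n :
  sup_dist f g <= n <-> forall x y, dist x y <= hull_fun f x + hull_fun g y + n.
Proof.
split=> [/sup_dist_leP H x y|H]; first by have := hull_funD f x y; have := H y; lia.
apply/sup_dist_leP => x; split.
  have [y E] := hull_fun_tight f x; have := H y x.
  by rewrite dist_sym -E; lia.
by have [y E] := hull_fun_tight g x; have := H x y; lia.
Qed.

(** While some point has no tight partner, the value there can drop by one; the sum of all values
    decreases. *)
Lemma extremal_below (u : G -> nat) :
  (forall x y, dist x y <= u x + u y) ->
  exists f, forall x, hull_fun f x <= u x.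
Proof.
have [n] := ubnP (\sum_x u x); elim: n u => // n IH u; rewrite ltnS => le_u uD.
case: (boolP [forall x, exists y, u x + u y == dist x y]) => [tight|].
  have [|f fE] := @extremal_hull_vertex G u; last by exists f => x; rewrite fE.
  by rewrite /extremal tight andbT; apply/forallP => x; apply/forallP.
rewrite negb_forall => /existsP[x0]; rewrite negb_exists => /forallP loose.
(* The point [x0] is not tight with itself either, and its distance to itself is [0]. *)
have u_gt0 : 0 < u x0.
  by have := loose x0; rewrite distxx; lia.
pose u' x := if x == x0 then (u x0).-1 else u x.
have [||f fu'] := IH u'.
- apply: leq_trans le_u; rewrite (bigD1 x0) //= [ltnRHS](bigD1 x0) //= /u' eqxx.
  by rewrite (eq_bigr u) => [|x /negPf->//]; lia.
- move=> x y; rewrite /u'; have := uD x y; have := loose x; have := loose y.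
  case: (eqVneq x x0) => [->|_]; case: (eqVneq y x0) => [->|_]; rewrite ?distxx //.
  + by move=> *; lia.
  + by rewrite (dist_sym x); lia.
by exists f => x; apply: leq_trans (fu' x) _; rewrite /u'; case: eqP => [->|]; lia.
Qed.

(** The function [min(f, g) + 1] still dominates the distance, as [f] and [g] differ by at most [2];
    any extremal function below it is a midpoint. *)
Lemma sup_dist_midpoint f g :
  sup_dist f g <= 2 -> exists h, sup_dist f h <= 1 /\ sup_dist h g <= 1.
Proof.
move=> fg; have [|h hP] := @extremal_below (fun x => (minn (hull_fun f x) (hull_fun g x)).+1).
  move=> x y; have := hull_funD f x y; have := hull_funD g x y.
  by have /sup_dist_leP H := fg; have := H x; have := H y; lia.
(* An upper bound alone suffices: [d(x,y) <= h(x) + h(y) <= h(x) + k(y) + 1]. *)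
have le_h : forall k, (forall x, hull_fun h x <= (hull_fun k x).+1) -> sup_dist h k <= 1.
  move=> k H; apply/sup_dist_le_cross => x y.
  have := H y; have := hull_funD h x y.
  by lia.
have sup_sym k : sup_dist k h = sup_dist h k.
  by apply: eq_bigr => x _; rewrite distnC.
by exists h; rewrite sup_sym; split; apply: le_h => x; have := hP x; lia.
Qed.

Lemma dist_hull_le2 f g : sup_dist f g <= 2 -> @dist (hull G) f g <= 2.
Proof.
(* Adjacency asks for sup-distance exactly [1], so the midpoint may coincide with an end. *)
have step k l : sup_dist k l <= 1 -> k = l \/ @adj (hull G) k l.
  rewrite leq_eqVlt => /orP[|]; first by right.
  rewrite ltnS => /sup_dist_leP H; left; apply: hull_fun_inj => x.
  by have := H x; lia.
move=> /sup_dist_midpoint[h [/step fh /step hg]].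
case: fh => [->|fh]; case: hg => [<-|hg].
- by rewrite distxx.
- exact: leqW (adj_dist hg).
- exact: leqW (adj_dist fh).
- by apply: (@dist_le_path (hull G) f [:: h; g]); apply/and3P.
Qed.

Lemma path_sup_dist f p :
  path (@adj (hull G)) f p -> sup_dist f (last f p) <= size p.
Proof.
elim: p f => [|g p IH] f /=; first by move=> _; apply/sup_dist_leP => x; rewrite addn0.
case/andP=> /eqP fg /IH/sup_dist_leP H; apply/sup_dist_leP => x.
have /sup_dist_leP/(_ x) : sup_dist f g <= 1 by rewrite fg.
have := H x; move: (hull_fun _ x) (hull_fun (last g p) x) (size p) (hull_fun f x) => *.
lia.
Qed.

(** The cardinality bound ensures that a value at most [2] is a true distance and not the default
    [#|hull G|]. *)
Lemma sup_dist_le2 f g :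
  2 < #|hull G| -> @dist (hull G) f g <= 2 -> sup_dist f g <= 2.
Proof.
move=> lt2 le2; have [p [fp lp sp]] := dist_path (leq_ltn_trans le2 lt2).
by have := path_sup_dist fp; rewrite lp sp => /leq_trans; apply.
Qed.

End HullDistance.

(** * Chordality of the square of the hull *)

Theorem theorem4 (G : sgraph) (hG : connected_graph G) :
  square_chordal G -> square_chordal (hull G).
Proof.
move=> /chordal_elimination_order[idx idxP] c szc cyc.
have [par parP] := thick_ball_subtree hG idxP.
have card_hull : 2 < #|hull G|.
  case: cyc => uc _ _; apply: (@leq_trans (size c)); first exact: ltnW.
  by rewrite -(card_uniqP uc) max_card.
have adj2 (f g : hull_vertex G) : @adj (power (hull G) 2) f g -> sup_dist f g <= 2.
  by case/andP=> _; apply: sup_dist_le2.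
have [f0 f0c] : exists f, f \in c by case: (c) szc => // f s _; exists f; rewrite mem_head.
have [x0 _] : exists x : G, predT x.
  have [g [h [_ _ _ _ [g_h _]]]] := induced_cycle_nonadjacent szc cyc f0c.
  case: (pickP (@predT G)) => [x|none]; [by exists x|exfalso; move: g_h].
  suff -> : g = h by rewrite eqxx.
  by apply: hull_fun_inj => x; have := none x.
(* [node f] is the top of the intersection of the subtrees
   [thick_ball x (f x)], found as the lowest of their tops. *)
have /fin_all_exists[node nodeP] : forall f : hull_vertex G, exists n : G,
    (exists x : G, subtree idx par n (@thick_ball G idx x (hull_fun f x))) /\
    forall y : G, exists t : G,
      subtree idx par t (@thick_ball G idx y (hull_fun f y)) /\ idx t <= idx n.
  move=> f; have /fin_all_exists[top topP] := fun x => parP x (hull_fun f x).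
  case: (@arg_maxnP _ x0 predT (fun x => idx (top x)) isT) => x _ xmax.
  exists (top x); split; first by exists x; apply: topP.
  by move=> y; exists (top y); split; [exact: topP|exact: (xmax y isT)].
(* The node of [f] is the top of some ball of [f]. That ball meets the ball of [g] at [y], whose top
   has no larger index, so the walk up to [node f] stays in the latter. *)
have node_in f g (y : G) : sup_dist f g <= 2 -> idx (node g) <= idx (node f) ->
    node f \in @thick_ball G idx y (hull_fun g y).
  move=> fg le_n; have [[x xP] _] := nodeP f; have [_ /(_ y)[t [tP le_t]]] := nodeP g.
  have /(thick_ball_meet hG idxP)[i ix iy] :
    dist x y <= hull_fun f x + hull_fun g y + 2.
    by have /sup_dist_le_cross := fg; apply.
  apply: (subtree_top_in _ xP tP ix iy); first exact: elimination_order_inj idxP.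
  exact: leq_trans le_t le_n.
(* Largest index means lowest node. This [node f] lies in every ball of both cycle neighbours [g]
   and [h] of [f], which forces [g] and [h] to be adjacent in the square. *)
case: (@arg_maxnP _ f0 (mem c) (idx \o node) f0c) => f fc fmax.
have [g [h [gc hc fg fh [g_h /negP ngh]]]] := induced_cycle_nonadjacent szc cyc fc.
apply: ngh; rewrite /= /power_adj g_h; apply: dist_hull_le2.
apply/sup_dist_le_cross => y z; apply/(thick_ball_meet hG idxP).
by exists (node f); apply: node_in; rewrite ?adj2 //; apply: fmax.
Qed.
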